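(* Let $(A,\mu,T)$ be a Rota-Baxter algebra of weight $\lambda$. If $(A[[t]],\mu_t,T_t)$ and $(A[[t]],\mu'_t,T'_t)$ are two equivalent $1$-parameter formal deformations of $(A,\mu,T)$, then their infinitesimals $(\mu_1,T_1)$ and $(\mu_1',T_1')$ are in the same cohomology class in $\mathrm{H}^\bullet_{\mathrm{RBA}_\lambda}(A)$.
   Context: $\mathbf{k}$ is a field of characteristic $0$, $\lambda\in\mathbf{k}$; everything is over $\mathbf{k}$. A Rota-Baxter algebra of weight $\lambda$ is $(A,\mu=\cdot,T)$ with $(A,\mu)$ associative and $T:A\to A$ linear with $T(a)T(b)=T(aT(b)+T(a)b+\lambda ab)$. Write $a_{i,j}=a_i\otimes\cdots\otimes a_j$ (empty if $i>j$). **Formal deformation.** For linear maps $\mu_i:A\otimes A\to A$ and $T_i:A\to A$ ($i\geqslant0$), the pair $(\mu_t=\sum\mu_it^i,T_t=\sum T_it^i)$ is a $1$-parameter formal deformation of $(A,\mu,T)$ if (extended $\mathbf{k}[[t]]$-linearly) it makes the $\mathbf{k}[[t]]$-module $A[[t]]$ into a Rota-Baxter algebra of weight $\lambda$ over $\mathbf{k}[[t]]$ and $(\mu_0,T_0)=(\mu,T)$. Its infinitesimal is the pair $(\mu_1,T_1)$, which is a $2$-cocycle of $\mathrm{C}^\bullet_{\mathrm{RBA}_\lambda}(A)$. A formal isomorphism from $(A[[t]],\mu'_t,T'_t)$ to $(A[[t]],\mu_t,T_t)$ is a power series $\psi_t=\sum_{i\geqslant0}\psi_it^i$ with $\psi_i:A\to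 A$ linear, $\psi_0=\mathrm{Id}_A$, such that $\psi_t\circ\mu'_t=\mu_t\circ(\psi_t\otimes\psi_t)$ and $\psi_t\circ T_t'=T_t\circ\psi_t$; if one exists the deformations are called equivalent. **Cochain complex.** Let $\mathrm{C}^n_{\mathrm{Alg}}(A)=\mathrm{C}^n_{\mathrm{RBO}_\lambda}(A)=\mathrm{Hom}(A^{\otimes n},A)$, $n\geqslant0$. - $\delta^n(f)(a_{1,n+1})=(-1)^{n+1}a_1f(a_{2,n+1})+\sum_{i=1}^n(-1)^{n-i+1}f(a_{1,i-1}\otimes a_ia_{i+1}\otimes a_{i+2,n+1})+f(a_{1,n})a_{n+1}$. - With $a\star b=aT(b)+T(a)b+\lambda ab$, $a\rhd x=T(a)x-T(ax)$, $x\lhd a=xT(a)-T(xa)$: $\partial^n(f)(a_{1,n+1})=(-1)^{n+1}a_1\rhd f(a_{2,n+1})+\sum_{i=1}^n(-1)^{n-i+1}f(a_{1,i-1}\otimes a_i\star a_{i+1}\otimes a_{i+2,n+1})+f(a_{1,n})\lhd a_{n+1}$. - $\Phi^0=\mathrm{Id}$ and for $n\geqslant1$: $\Phi^n(f)(a_{1,n})=f(T(a_1)\otimes\cdots\otimes T(a_n))-\sum_{k=0}^{n-1}\lambda^{n-k-1}\sum_{1\leqslant i_1<\cdots<i_k\leqslant n}T\circ f(a_{1,i_1-1}\otimes T(a_{i_1})\otimes a_{i_1+1,i_2-1}\otimes T(a_{i_2})\otimes\cdots\otimes T(a_{i_k})\otimes a_{i_k+1,n})$. - $\mathrm{C}^0_{\mathrm{RBA}_\lambda}(A)=\mathrm{C}^0_{\mathrm{Alg}}(A)$,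 $\mathrm{C}^n_{\mathrm{RBA}_\lambda}(A)=\mathrm{C}^n_{\mathrm{Alg}}(A)\oplus\mathrm{C}^{n-1}_{\mathrm{RBO}_\lambda}(A)$ for $n\geqslant1$, with $d^n(f,g)=(\delta^n(f),-\partial^{n-1}(g)-\Phi^n(f))$. Its cohomology is $\mathrm{H}^\bullet_{\mathrm{RBA}_\lambda}(A)$. *)

(* Defs.v *)
From HB Require Import structures.
From mathcomp Require Import all_boot all_order all_algebra.
From mathcomp Require Import boolp functions.

Set Implicit Arguments.
Unset Strict Implicit.
Unset Printing Implicit Defensive.

Import GRing.Theory.

Local Open Scope ring_scope.

Section RotaBaxter.
Variables (K : comNzRingType) (V : lmodType K) (lam : K).
Variables (mu : V -> V -> V) (T : V -> V).

Definition star (a b : V) : V := mu a (T b) + mu (T a) b + lam *: mu a b.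
Definition lact (a x : V) : V := mu (T a) x - T (mu a x).
Definition ract (x a : V) : V := mu x (T a) - T (mu x a).

End RotaBaxter.

(* The product is a bare bilinear map, since MathComp algebras are unital. *)
Record is_RBA (K : comNzRingType) (V : lmodType K) (lam : K)
    (mu : {bilinear V -> V -> V}) (T : {linear V -> V}) : Prop := IsRBA {
  rba_assoc : forall a b c, mu (mu a b) c = mu a (mu b c);
  rba_RB : forall a b, mu (T a) (T b) = T (star lam mu T a b)
}.

Section TriangularSums.
Variables (V : nmodType) (F : nat -> nat -> nat -> V).

Lemma triangular_swap n :
  \sum_(i < n.+1) \sum_(j < (n - i).+1) F i j (n - i - j)%N =
  \sum_(j < n.+1) \sum_(i < (n - j).+1) F i j (n - i - j)%N.
Proof.
transitivity (\sum_(i < n.+1) \sum_(j < n.+1 | (j <= n - i)%N) F i j (n - i - j)%N).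
  by apply: eq_bigr => i _; rewrite (big_ord_narrow_leq (leq_subr _ _)).
rewrite (exchange_big_dep predT) //=; apply: eq_bigr => j _.
transitivity (\sum_(i < n.+1 | (i <= n - j)%N) F i j (n - i - j)%N).
  apply: eq_bigl => i; rewrite -ltnS -(ltnS i) -!subSn ?leq_ord //.
  by rewrite -subn_gt0 -(subn_gt0 i) -!subnDA addnC.
by rewrite (big_ord_narrow_leq (leq_subr _ _)).
Qed.

End TriangularSums.

Lemma triangular_assoc (V : nmodType) (F : nat -> nat -> nat -> V) n :
  \sum_(i < n.+1) \sum_(j < (n - i).+1) F i j (n - i - j)%N =
  \sum_(m < n.+1) \sum_(i < m.+1) F i (m - i)%N (n - m)%N.
Proof.
transitivity (\sum_(i < n.+1) \sum_(l < (n - i).+1) F i (n - i - l)%N l).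
  apply: eq_bigr => i _; rewrite (reindex_inj rev_ord_inj) /=.
  by apply: eq_bigr => j _; rewrite subSS subKn // -ltnS.
rewrite (triangular_swap (fun i l j => F i j l)) (reindex_inj rev_ord_inj) /=.
apply: eq_bigr => m _; rewrite subSS subKn -1?ltnS //.
apply: eq_bigr => i _; congr F.
have le_mn : (m <= n)%N by rewrite -ltnS.
by rewrite -subnDA addnC subnDA subKn.
Qed.

Section Cauchy.
Variables U V W : nmodType.

Definition cauchy (op : U -> V -> W) (u : nat -> U) (v : nat -> V) : nat -> W :=
  fun n => \sum_(i < n.+1) op (u i) (v (n - i)%N).

End Cauchy.

(* [powser V] is V[[t]]; the series \sum_n v_n t^n is the function n |-> v_n. *)
Definition powser (V : Type) : Type := nat -> V.

HB.instance Definition _ (V : choiceType) := Choice.copy (powser V) (nat -> V).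
HB.instance Definition _ (V : zmodType) := GRing.Zmodule.copy (powser V) (nat -> V).

Definition powserC (V : zmodType) (v : V) : powser V :=
  fun n => if n is 0 then v else 0.

Section PowserRing.
Variable R : comNzRingType.
Implicit Types f g h : powser R.

Definition powser_mul f g : powser R := cauchy *%R f g.

Fact powser_mulA : associative powser_mul.
Proof.
move=> f g h; apply/funext => n; rewrite /powser_mul /cauchy.
transitivity (\sum_(i < n.+1) \sum_(j < (n - i).+1)
    f i * (g j * h (n - i - j)%N)).
  by apply: eq_bigr => i _; rewrite big_distrr.
rewrite (triangular_assoc (fun i j l => f i * (g j * h l))).
by apply: eq_bigr => i _; rewrite big_distrl; apply: eq_bigr => j _; rewrite mulrA.
Qed.

Fact powser_mulC : commutative powser_mul.
Proof.
move=> f g; apply/funext => n; rewrite /powser_mul /cauchy.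
rewrite (reindex_inj rev_ord_inj) /=; apply: eq_bigr => i _.
by rewrite mulrC subSS subKn // -ltnS.
Qed.

Fact powser_mul1 : left_id (powserC 1) powser_mul.
Proof.
move=> f; apply/funext => n; rewrite /powser_mul /cauchy big_ord_recl /=.
by rewrite mul1r subn0 big1 ?addr0 // => i _; rewrite mul0r.
Qed.

Fact powser_mulDl : left_distributive powser_mul +%R.
Proof.
move=> f g h; apply/funext => n.
rewrite -[RHS]/(powser_mul f h n + powser_mul g h n) -big_split /=.
by apply: eq_bigr => i _; rewrite -mulrDl.
Qed.

Fact powser_1neq0 : powserC 1 != 0 :> powser R.
Proof. by apply/eqP => /(congr1 (@^~ 0%N)) /eqP; rewrite oner_eq0. Qed.

HB.instance Definition _ := GRing.Zmodule_isComNzRing.Build (powser R)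
  powser_mulA powser_mulC powser_mul1 powser_mulDl powser_1neq0.

End PowserRing.

Section PowserModule.
Variables (R : comNzRingType) (V : lmodType R).
Implicit Types (f g : powser R) (v w : powser V).

Definition powser_scale f v : powser V := cauchy *:%R f v.

Fact powser_scaleA f g v :
  powser_scale f (powser_scale g v) = powser_scale (f * g) v.
Proof.
apply/funext => n; rewrite /powser_scale /cauchy.
transitivity (\sum_(i < n.+1) \sum_(j < (n - i).+1)
    f i *: (g j *: v (n - i - j)%N)).
  by apply: eq_bigr => i _; rewrite scaler_sumr.
rewrite (triangular_assoc (fun i j l => f i *: (g j *: v l))).
apply: eq_bigr => i _; rewrite scaler_suml.
by apply: eq_bigr => j _; rewrite scalerA.
Qed.

Fact powser_scale1 : left_id 1 powser_scale.
Proof.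
move=> v; apply/funext => n; rewrite /powser_scale /cauchy big_ord_recl /=.
by rewrite scale1r subn0 big1 ?addr0 // => i _; rewrite scale0r.
Qed.

Fact powser_scaleDr : right_distributive powser_scale +%R.
Proof.
move=> f v w; apply/funext => n.
rewrite -[RHS]/(powser_scale f v n + powser_scale f w n) -big_split /=.
by apply: eq_bigr => i _; rewrite -scalerDr.
Qed.

Fact powser_scaleDl v :
  {morph powser_scale^~ v : f g / f + g}.
Proof.
move=> f g; apply/funext => n.
rewrite -[RHS]/(powser_scale f v n + powser_scale g v n) -big_split /=.
by apply: eq_bigr => i _; rewrite -scalerDl.
Qed.

HB.instance Definition _ := GRing.Zmodule_isLmodule.Build (powser R) (powser V)
  powser_scaleA powser_scale1 powser_scaleDr powser_scaleDl.

End PowserModule.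

Section Extension.
Variables (k : comNzRingType) (A : lmodType k).

(* A power series \sum_i T_i t^i of linear maps on A has exactly one
   k[[t]]-linear extension to A[[t]]; likewise for bilinear maps. *)
Section Linear.
Variable T : nat -> {linear A -> A}.

Definition ext1 (a : powser A) : powser A :=
  fun n => \sum_(i < n.+1) T i (a (n - i)%N).

Fact ext1_linear : linear ext1.
Proof.
move=> f a b; apply/funext => n.
rewrite -[RHS]/(powser_scale f (ext1 a) n + ext1 b n) /ext1.
under eq_bigr => i _ do rewrite linearD linear_sum.
rewrite big_split /=; congr (_ + _).
transitivity (\sum_(i < n.+1) \sum_(j < (n - i).+1)
    f j *: T i (a (n - i - j)%N)).
  by apply: eq_bigr => i _; apply: eq_bigr => j _; rewrite linearZ.
rewrite (triangular_swap (fun i j l => f j *: T i (a l))).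
apply: eq_bigr => j _; rewrite scaler_sumr; apply: eq_bigr => i _.
by rewrite -!subnDA addnC.
Qed.

HB.instance Definition _ :=
  GRing.isLinear.Build (powser k) (powser A) (powser A) _ ext1 ext1_linear.

End Linear.

Section Bilinear.
Variable mu : nat -> {bilinear A -> A -> A}.

Definition ext2 (a b : powser A) : powser A :=
  fun n => \sum_(i < n.+1) \sum_(j < (n - i).+1) mu i (a j) (b (n - i - j)%N).

Fact ext2_bilinear : bilinear_for *:%R *:%R ext2.
Proof.
have scal f (g : nat -> powser A) n :
    \sum_(i < n.+1) (f *: g i) (n - i)%N =
    (f *: ((fun n => \sum_(i < n.+1) g i (n - i)%N) : powser A)) n.
  rewrite -[RHS]/(\sum_(j < n.+1) f j *: \sum_(i < (n - j).+1) g i (n - j - i)%N).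
  rewrite -[LHS]/(\sum_(i < n.+1) \sum_(j < (n - i).+1) f j *: g i (n - i - j)%N).
  rewrite (triangular_swap (fun i j l => f j *: g i l)).
  apply: eq_bigr => j _; rewrite scaler_sumr; apply: eq_bigr => i _.
  by rewrite -!subnDA addnC.
split=> [b f a a'|a f b b']; apply/funext => n.
- rewrite -[RHS]/((f *: ext2 a b) n + ext2 a' b n).
  rewrite -(scal f (fun i => cauchy (mu i) a b)) -big_split /=.
  apply: eq_bigr => i _; move: (n - i)%N => m.
  rewrite -[X in _ = X + _]/(\sum_(p < m.+1) f p *: cauchy (mu i) a b (m - p)%N).
  rewrite /cauchy.
  under [X in _ = X + _]eq_bigr => p _ do rewrite scaler_sumr.
  rewrite (triangular_assoc (fun p q l => f p *: mu i (a q) (b l))) -big_split /=.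
  apply: eq_bigr => q _; rewrite linearDl linear_sumlz; congr (_ + _).
  by apply: eq_bigr => p _; rewrite linearZl_LR.
rewrite -[RHS]/((f *: ext2 a b) n + ext2 a b' n).
rewrite -(scal f (fun i => cauchy (mu i) a b)) -big_split /=.
apply: eq_bigr => i _; move: (n - i)%N => m.
rewrite -[X in _ = X + _]/(\sum_(p < m.+1) f p *: cauchy (mu i) a b (m - p)%N).
rewrite /cauchy.
under [X in _ = X + _]eq_bigr => p _ do rewrite scaler_sumr.
rewrite (triangular_swap (fun p q l => f p *: mu i (a q) (b l))) -big_split /=.
apply: eq_bigr => q _; rewrite linearDr linear_sumr; congr (_ + _).
by apply: eq_bigr => p _; rewrite linearZr_LR -!subnDA addnC.
Qed.

HB.instance Definition _ := bilinear_isBilinear.Build (powser k)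
  (powser A) (powser A) (powser A) _ _ ext2 ext2_bilinear.

End Bilinear.

End Extension.

Section Deformation.
Variables (k : fieldType) (A : lmodType k) (lam : k).

Record is_deformation (mu : {bilinear A -> A -> A}) (T : {linear A -> A})
    (mut : nat -> {bilinear A -> A -> A}) (Tt : nat -> {linear A -> A}) : Prop :=
  IsDeformation {
    deformation_RBA : is_RBA (powserC lam) (ext2 mut) (ext1 Tt);
    deformation_mu0 : forall a b, mut 0%N a b = mu a b;
    deformation_T0 : forall a, Tt 0%N a = T a
  }.

Record is_formal_iso (mut' : nat -> {bilinear A -> A -> A})
    (Tt' : nat -> {linear A -> A}) (mut : nat -> {bilinear A -> A -> A})
    (Tt : nat -> {linear A -> A}) (psi : nat -> {linear A -> A}) : Prop :=
  IsFormalIso {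
    iso_psi0 : forall a, psi 0%N a = a;
    iso_mu : forall a b : powser A,
      ext1 psi (ext2 mut' a b) = ext2 mut (ext1 psi a) (ext1 psi b);
    iso_T : forall a : powser A, ext1 psi (ext1 Tt' a) = ext1 Tt (ext1 psi a)
  }.

Definition equivalent mut Tt mut' Tt' : Prop :=
  exists psi, is_formal_iso mut' Tt' mut Tt psi.

End Deformation.

Section Complex.
Variables (k : fieldType) (A : lmodType k).

(* Hom(A^{\otimes n}, A) is the set of multilinear elements of [cochain n]. *)
Definition cochain (n : nat) : zmodType := ('I_n -> A) -> A.

Definition multilinear n (f : cochain n) : Prop :=
  forall (a : 'I_n -> A) (i : 'I_n),
    linear (fun x => f (fun j => if j == i then x else a j)).

(* Replaces the entries i and i+1 (counted from 0) by op a_i a_{i+1}. *)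
Definition contract (op : A -> A -> A) n (i : 'I_n) (a : 'I_n.+1 -> A) :
    'I_n -> A := fun j =>
  if (j < i)%N then a (lift ord_max j)
  else if j == i then op (a (lift ord_max j)) (a (lift ord0 j))
  else a (lift ord0 j).

(* The Hochschild differential of the algebra (A, op) with coefficients in the
   bimodule with actions l and r.  The index i is counted from 0, so that the
   sign is n - i where counting from 1 gives n - i + 1. *)
Definition hochschild (op l r : A -> A -> A) n (f : cochain n) : cochain n.+1 :=
  fun a =>
    (-1) ^+ n.+1 *: l (a ord0) (f (fun i => a (lift ord0 i)))
    + \sum_(i < n) (-1) ^+ (n - i) *: f (contract op i a)
    + r (f (fun i => a (lift ord_max i))) (a ord_max).

Variables (lam : k) (mu : A -> A -> A) (T : A -> A).

Definition delta n : cochain n -> cochain n.+1 := @hochschild mu mu mu n.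

Definition partial n : cochain n -> cochain n.+1 :=
  @hochschild (star lam mu T) (lact mu T) (ract mu T) n.

(* The indices i_1 < ... < i_k are gathered in the set I. *)
Definition Phi n : cochain n -> cochain n :=
  match n with
  | 0 => id
  | m.+1 => fun f a =>
      f (fun i => T (a i))
      - \sum_(j < m.+1) lam ^+ (m.+1 - j - 1) *:
          \sum_(I : {set 'I_m.+1} | #|I| == j)
            T (f (fun i => if i \in I then T (a i) else a i))
  end.

Definition cochainRBA (n : nat) : zmodType :=
  match n with
  | 0 => cochain 0
  | m.+1 => (cochain m.+1 * cochain m)%type
  end.

Definition multilinearRBA n : cochainRBA n -> Prop :=
  match n with
  | 0 => @multilinear 0
  | m.+1 => fun x => multilinear x.1 /\ multilinear x.2
  end.

Definition dRBA n : cochainRBA n -> cochainRBA n.+1 :=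
  match n with
  | 0 => fun f => (delta f, - Phi f)
  | m.+1 => fun x => (delta x.1, - partial x.2 - Phi x.1)
  end.

Definition cocycle n (x : cochainRBA n) : Prop :=
  multilinearRBA x /\ dRBA x = 0.

Definition coboundary n : cochainRBA n -> Prop :=
  match n with
  | 0 => fun x => x = 0
  | m.+1 => fun x => exists2 y : cochainRBA m, multilinearRBA y & x = dRBA y
  end.

(* x and y represent the same element of H^n *)
Definition same_class n (x y : cochainRBA n) : Prop :=
  [/\ cocycle x, cocycle y & coboundary (x - y)].

End Complex.

Definition infinitesimal (k : fieldType) (A : lmodType k)
    (mut : nat -> {bilinear A -> A -> A}) (Tt : nat -> {linear A -> A}) :
    cochainRBA A 2 :=
  (fun a => mut 1%N (a ord0) (a ord_max), fun a => Tt 1%N (a ord0)).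

(* Main.v *)
Require Import Defs.
From mathcomp Require Import all_boot all_order all_algebra.
From mathcomp Require Import boolp functions.

Set Implicit Arguments.
Unset Strict Implicit.
Unset Printing Implicit Defensive.

Import GRing.Theory.

Local Open Scope ring_scope.

(** Each identity that holds over k[[t]] gives, through its coefficient of t,
    a linear relation between the first-order terms.  Write f for psi_1.

    Associativity of mu_t and the Rota-Baxter identity of (mu_t, T_t) become
    [deformation_assoc1] and [deformation_RB1].  After all terms are moved to
    one side, the first is delta mu_1 = 0 and the second is
    partial T_1 + Phi mu_1 = 0: the terms that contain mu_1 are exactly those of
    Phi mu_1, and the terms that contain T_1 assemble into the actions
    T(a)x - T(ax), xT(a) - T(xa) and the product a * b that define partial.  Hence infinitesimals are cocycles ([infinitesimal_cocycle]).

    The two compatibilities of psi_t become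
      mu'_1(a, b) + f(ab) = a f(b) + f(a) b + mu_1(a, b),
      T'_1(a) + f(T(a)) = T(f(a)) + T_1(a),
    that is mu'_1 - mu_1 = delta f and T'_1 - T_1 = - Phi f.  The difference of
    the infinitesimals is thus the coboundary of (- f, 0), where the
    component in C^0_RBO is 0 because - Phi f already accounts for all of
    T'_1 - T_1 ([formal_iso_coboundary]).

    The remaining lemmas make delta, partial and Phi explicit in the
    arities 0, 1, 2 that occur here. *)

Section Coefficients.
Variables (k : comNzRingType) (A : lmodType k).
Implicit Types (T : nat -> {linear A -> A}) (mu : nat -> {bilinear A -> A -> A}).
Implicit Types a b : powser A.

Lemma ext1_coef0 T a : ext1 T a 0%N = T 0%N (a 0%N).
Proof. by rewrite /ext1 big_ord1. Qed.

Lemma ext1_coef1 T a : ext1 T a 1%N = T 0%N (a 1%N) + T 1%N (a 0%N).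
Proof. by rewrite /ext1 big_ord_recl big_ord1. Qed.

Lemma ext2_coef0 mu a b : ext2 mu a b 0%N = mu 0%N (a 0%N) (b 0%N).
Proof. by rewrite /ext2 !big_ord1. Qed.

Lemma ext2_coef1 mu a b :
  ext2 mu a b 1%N = mu 0%N (a 0%N) (b 1%N) + mu 0%N (a 1%N) (b 0%N)
                    + mu 1%N (a 0%N) (b 0%N).
Proof. by rewrite /ext2 big_ord_recl !big_ord1 big_ord_recl big_ord1. Qed.

Lemma powser_addE a b n : (a + b) n = a n + b n.
Proof. by []. Qed.

Lemma powser_scaleC (c : k) a n : (powserC c *: a) n = c *: a n.
Proof.
rewrite -[LHS]/(\sum_(i < n.+1) powserC c i *: a (n - i)%N).
by rewrite big_ord_recl subn0 big1 ?addr0 // => i _; rewrite scale0r.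
Qed.

End Coefficients.

Section LowDegree.
Variables (k : fieldType) (A : lmodType k).

Lemma lift0_ord1 : lift ord0 ord0 = ord_max :> 'I_2.
Proof. exact/val_inj. Qed.

Lemma lift_max_ord0 n : lift ord_max ord0 = ord0 :> 'I_n.+2.
Proof. exact/val_inj. Qed.

Lemma lift0_max n : lift ord0 ord_max = ord_max :> 'I_n.+2.
Proof. exact/val_inj. Qed.

Lemma lift_max_max : lift ord_max ord_max = lift ord0 ord0 :> 'I_3.
Proof. exact/val_inj. Qed.

Lemma hochschild_zero (op l r : A -> A -> A) :
  (forall x, l x 0 = 0) -> (forall x, r 0 x = 0) ->
  hochschild op l r (0 : cochain A 0) = 0.
Proof.
move=> l0 r0; apply/funext => a.
by rewrite /hochschild big_ord0 l0 r0 scaler0 !addr0.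
Qed.

(** Cochains of arity 1 and 2 are presented through curried functions, the form
    in which the coefficients mu_1, T_1 and psi_1 are given. *)
Lemma hochschild1E (op l r : A -> A -> A) (g : A -> A) a :
  hochschild op l r (fun b : 'I_1 -> A => g (b ord0)) a =
  l (a ord0) (g (a ord_max)) - g (op (a ord0) (a ord_max))
  + r (g (a ord0)) (a ord_max).
Proof.
rewrite /hochschild big_ord1 /contract /= lift0_ord1 lift_max_ord0.
by rewrite sqrrN expr1n scale1r subn0 expr1 scaleN1r.
Qed.

Lemma hochschild2E (op l r : A -> A -> A) (f : A -> A -> A) a :
  let b := a (lift ord0 ord0) in
  hochschild op l r (fun b : 'I_2 -> A => f (b ord0) (b ord_max)) a =
  - l (a ord0) (f b (a ord_max))
  + (f (op (a ord0) b) (a ord_max) - f (a ord0) (op b (a ord_max)))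
  + r (f (a ord0) b) (a ord_max).
Proof.
rewrite /hochschild big_ord_recl big_ord1 /contract /=.
rewrite lift0_max lift_max_ord0 lift_max_max.
rewrite -[bump 0 0]/1%N subn1 subn0 exprS sqrrN expr1n mulr1 expr1.
by rewrite !scaleN1r scale1r.
Qed.

(** In arity 2 the inner sum of Phi over one-element index sets becomes a sum
    over the argument to which T is applied. *)
Lemma sum_card1 (V : nmodType) (I : finType) (F : {set I} -> V) :
  \sum_(X : {set I} | #|X| == 1%N) F X = \sum_i F [set i].
Proof.
transitivity (\sum_(X in [set [set i] | i in [set: I]]) F X).
  apply: eq_bigl => X; apply/cards1P/imsetP => [[i ->]|[i _ ->]].
    by exists i.
  by exists i.
rewrite big_imset /=; last by move=> i j _ _; apply: set1_inj.
by apply: eq_bigl => i; rewrite in_setT.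
Qed.

Lemma Phi1E (lam : k) (T : A -> A) (g : A -> A) a :
  Phi lam T (fun b : 'I_1 -> A => g (b ord0)) a = g (T (a ord0)) - T (g (a ord0)).
Proof.
rewrite /Phi big_ord1 expr0 scale1r.
under eq_bigl => X do rewrite cards_eq0.
by rewrite big_pred1_eq inE.
Qed.

(** The three subtracted terms are T applied to the three terms of the product
    star, with f in place of mu. *)
Lemma Phi2E (lam : k) (T : A -> A) (f : A -> A -> A) a :
  let x := a ord0 in let y := a ord_max in
  Phi lam T (fun b : 'I_2 -> A => f (b ord0) (b ord_max)) a =
  f (T x) (T y) - (lam *: T (f x y) + (T (f (T x) y) + T (f x (T y)))).
Proof.
rewrite /Phi big_ord_recl big_ord1 /= subn0 subnn expr1 expr0 scale1r.
under eq_bigl => X do rewrite cards_eq0.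
by rewrite big_pred1_eq sum_card1 big_ord_recl big_ord1 !inE.
Qed.

Lemma multilinear1 (g : {linear A -> A}) :
  multilinear (fun b : 'I_1 -> A => g (b ord0)).
Proof. by move=> a i c x y; rewrite !ord1 /= linearP. Qed.

Lemma multilinear2 (f : {bilinear A -> A -> A}) :
  multilinear (fun b : 'I_2 -> A => f (b ord0) (b ord_max)).
Proof.
move=> a i c x y; case: (unliftP ord0 i) => [j|] ->; last first.
  by rewrite /= linearPl.
by rewrite ord1 lift0_ord1 /= linearPr.
Qed.

End LowDegree.

Section Infinitesimal.
Variables (k : fieldType) (A : lmodType k) (lam : k).
Variables (mu : {bilinear A -> A -> A}) (T : {linear A -> A}).

Section Cocycle.
Variables (mut : nat -> {bilinear A -> A -> A}) (Tt : nat -> {linear A -> A}).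
Hypothesis defA : is_deformation lam mu T mut Tt.

Lemma deformation_assoc1 x y z :
  mu (mut 1%N x y) z + mut 1%N (mu x y) z =
  mu x (mut 1%N y z) + mut 1%N x (mu y z).
Proof.
case: defA => -[assoc _] mu0 _.
have /= := congr1 (@^~ 1%N) (assoc (powserC x) (powserC y) (powserC z)).
by rewrite !(ext2_coef1, ext2_coef0) !mu0 /= !(linear0l, linear0r) !add0r addr0.
Qed.

(** The coefficient of t in T_t(a) T_t(b) = T_t(a * b): besides T_1 (a * b), the
    right side has T applied to the first-order part of the deformed product
    star, to which both mu_1 and T_1 contribute. *)
Lemma deformation_RB1 x y :
  mu (T x) (Tt 1%N y) + mu (Tt 1%N x) (T y) + mut 1%N (T x) (T y) =
  T (mu x (Tt 1%N y) + mut 1%N x (T y) + (mu (Tt 1%N x) y + mut 1%N (T x) y)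
     + lam *: mut 1%N x y)
  + Tt 1%N (star lam mu T x y).
Proof.
case: defA => -[_ RB] mu0 T0.
have /= := congr1 (@^~ 1%N) (RB (powserC x) (powserC y)).
rewrite !(ext2_coef1, ext2_coef0, ext1_coef0, ext1_coef1) /star.
rewrite !(powser_addE, powser_scaleC).
rewrite !(ext2_coef1, ext2_coef0, ext1_coef0, ext1_coef1).
by rewrite !mu0 !T0 /= !(linear0, linear0l, linear0r, addr0, add0r).
Qed.

Lemma infinitesimal_cocycle : cocycle lam mu T (infinitesimal mut Tt).
Proof.
split; first by split; [exact: multilinear2 | exact: multilinear1].
congr pair; apply/funext => a.
- rewrite /delta hochschild2E.
  rewrite [LHS]addrC addrCA [X in _ + X]addrA deformation_assoc1.
  by rewrite addrK addNr.
rewrite -[LHS]/(- partial lam mu T _ a - Phi lam T _ a).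
rewrite /partial hochschild1E Phi2E /lact /ract -opprD -[RHS]oppr0; congr (- _).
(* Positive terms first: they form the left side of the first-order Rota-Baxter
   identity, and the negative ones, taken in its order, the right side. *)
rewrite !opprD (AC ((3*2)*(1*(1*2))) ((1*4*6)*((2*9)*(5*8)*7*3))) /=.
by rewrite deformation_RB1 !linearD linearZ /= -!opprD subrr.
Qed.

End Cocycle.

Section Coboundary.
Variables (mut mut' : nat -> {bilinear A -> A -> A}).
Variables (Tt Tt' : nat -> {linear A -> A}) (psi : nat -> {linear A -> A}).
Hypothesis defA : is_deformation lam mu T mut Tt.
Hypothesis defA' : is_deformation lam mu T mut' Tt'.
Hypothesis isoA : is_formal_iso mut' Tt' mut Tt psi.

Lemma formal_iso_mu1 x y :
  mut' 1%N x y + psi 1%N (mu x y) =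
  mu x (psi 1%N y) + mu (psi 1%N x) y + mut 1%N x y.
Proof.
case: defA defA' isoA => _ mu0 _ [_ mu0' _] [psi0 iso _].
have := congr1 (@^~ 1%N) (iso (powserC x) (powserC y)).
rewrite !(ext2_coef1, ext2_coef0, ext1_coef0, ext1_coef1).
by rewrite !mu0 !mu0' !psi0 /= !(linear0, linear0l, linear0r, add0r).
Qed.

Lemma formal_iso_T1 x :
  Tt' 1%N x + psi 1%N (T x) = T (psi 1%N x) + Tt 1%N x.
Proof.
case: defA defA' isoA => _ _ T0 [_ _ T0'] [psi0 _ iso].
have := congr1 (@^~ 1%N) (iso (powserC x)).
rewrite !(ext1_coef0, ext1_coef1).
by rewrite !T0 !T0' !psi0 /= !(linear0, add0r).
Qed.

(** The sign of psi_1 is due to the order of the difference: psi_t goes from the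
    primed deformation to the other one, so that psi_1 itself bounds the
    opposite difference. *)
Lemma formal_iso_coboundary :
  infinitesimal mut Tt - infinitesimal mut' Tt' =
  dRBA lam mu T ((fun a => (\- psi 1%N) (a ord0), 0) : cochainRBA A 1).
Proof.
congr pair; apply/funext => a.
- rewrite /delta hochschild1E /= !linearNl !linearNr /=.
  rewrite -[LHS]/(mut 1%N (a ord0) (a ord_max) - mut' 1%N (a ord0) (a ord_max)).
  (* Completes mu'_1 to the left side of the first-order identity; the second
     copy of psi_1 (ab) then is the middle term of delta. *)
  rewrite -(addrK (psi 1%N (mu (a ord0) (a ord_max))) (mut' 1%N _ _)).
  rewrite formal_iso_mu1 !opprD !opprK.
  by rewrite (AC (1*((2*1)*1)) (((2*5)*3)*(1*4))) /= subrr addr0.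
rewrite -[LHS]/(Tt 1%N (a ord0) - Tt' 1%N (a ord0)).
rewrite -[RHS]/(- partial lam mu T _ a - Phi lam T _ a).
rewrite /partial hochschild_zero => [|x|x]; last 2 first.
- by rewrite /lact !linear0r linear0 subr0.
- by rewrite /ract !linear0l linear0 subr0.
rewrite Phi1E oppr0 add0r /= linearN opprK opprD opprK /=.
rewrite -(addrK (psi 1%N (T (a ord0))) (Tt' 1%N (a ord0))) formal_iso_T1.
by rewrite !opprD opprK (AC (1*(2*1)) ((4*2)*(1*3))) /= subrr addr0.
Qed.

End Coboundary.
End Infinitesimal.

Theorem theorem6p5 (k : fieldType) (A : lmodType k) (lam : k)
    (mu : {bilinear A -> A -> A}) (T : {linear A -> A})
    (mut mut' : nat -> {bilinear A -> A -> A})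
    (Tt Tt' : nat -> {linear A -> A}) :
  [pchar k] =i pred0 ->
  is_RBA lam mu T ->
  is_deformation lam mu T mut Tt ->
  is_deformation lam mu T mut' Tt' ->
  equivalent mut Tt mut' Tt' ->
  same_class lam mu T (infinitesimal mut Tt) (infinitesimal mut' Tt').
Proof.
move=> _ _ defA defA' [psi isoA]; split.
- exact: infinitesimal_cocycle defA.
- exact: infinitesimal_cocycle defA'.
exists (fun a => (\- psi 1%N) (a ord0), 0).
  split; first exact: multilinear1.
  by move=> a i c x y; rewrite /= scaler0 addr0.
exact: (formal_iso_coboundary defA defA' isoA).
Qed.
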